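(* Let $a,b,c\in\mathbb{R}$ and $\lambda>0$ be such that $l:=2a+b^2+\lambda c(2+c)<0$. Then, for a stepsize $\Delta t>0$, the semi-tamed Euler scheme applied to the linear test equation $$dX(t)=aX(t^-)dt+bX(t^-)dW(t)+cX(t^-)dN(t),\qquad X(0)=X_0,$$ is mean-square stable if and only if $$\Delta t<\frac{-l}{(a+\lambda c)^2}.$$
   Context: $W$ is a scalar Brownian motion and $N$ a scalar Poisson process with intensity $\lambda$, on a common filtered probability space $(\Omega,\mathcal{F},(\mathcal{F}_t)_{t\ge 0},\mathbb{P})$ with respect to which both are adapted with increments independent of the past; $X_0$ is $\mathcal{F}_0$-measurable, real-valued, with $\mathbb{E}|X_0|^2<\infty$; $\overline{N}(t)=N(t)-\lambda t$. The semi-tamed Euler scheme for a drift $f=u+v$, diffusion coefficient $g$ and jump coefficient $h$ is $$Y_{n+1}=Y_n+u(Y_n)\Delta t+\lambda h(Y_n)\Delta t+\frac{\Delta t\,v(Y_n)}{1+\Delta t\|v(Y_n)\|}+g(Y_n)\Delta W_n+h(Y_n)\Delta\overline{N}_n,\qquad Y_0=X_0,$$ with $\Delta W_n=W((n+1)\Delta t)-W(n\Delta t)$ and $\Delta\overline{N}_n=\overline{N}((n+1)\Delta t)-\overline{N}(n\Delta t)$. Applied to the linear test equation (with $u(x)=ax$, $v=0$, $g(x)=bx$, $h(x)=cx$) it reads $$Y_{n+1}=Y_n+aY_n\Delta t+\lambda cY_n\Delta t+bY_n\Delta W_n+cY_n\Delta\overline{N}_n,\qquad n\ge0.$$ The scheme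 with stepsize $\Delta t$ is called mean-square stable if there exists a constant $0<L<1$ such that, for every such initial value $X_0$, $\mathbb{E}|Y_{n+1}|^2\le L\,\mathbb{E}|Y_n|^2$ for all $n\ge 0$. *)

(* Defs.v *)
From mathcomp Require Import all_boot all_order all_algebra.
From mathcomp Require Import all_classical all_reals all_analysis.
Set Implicit Arguments.
Unset Strict Implicit.
Unset Printing Implicit Defensive.
Import Order.TTheory GRing.Theory Num.Theory.
Import numFieldNormedType.Exports.
Local Open Scope classical_set_scope.
Local Open Scope ring_scope.

(* Time is indexed by R; filtrations and processes are constrained at
   nonnegative times only, their values at negative times being junk. *)

Record is_filtration (R : realType) (d : measure_display)
    (T : measurableType d) (F : R -> set (set T)) : Prop := IsFiltration {
  filtration_sigma : forall t : R, 0 <= t -> sigma_algebra setT (F t) ;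
  filtration_sub : forall t : R, 0 <= t -> F t `<=` measurable ;
  filtration_mono : forall s t : R, 0 <= s -> s <= t -> F s `<=` F t }.

Definition measurable_wrt (R : realType) (T : Type) (G : set (set T))
    (X : T -> R) : Prop :=
  forall B : set R, measurable B -> G (X @^-1` B).

Definition independent_of (R : realType) (d : measure_display)
    (T : measurableType d) (P : probability T R) (X : T -> R)
    (G : set (set T)) : Prop :=
  forall (B : set R) (A : set T), measurable B -> G A ->
    P (X @^-1` B `&` A) = (P (X @^-1` B) * P A)%E.

Definition increment (R : realType) (T : Type) (X : R -> T -> R) (s t : R) :
    T -> R :=
  fun w => X t w - X s w.

Record adapted_indep_increments (R : realType) (d : measure_display)
    (T : measurableType d) (P : probability T R) (F : R -> set (set T))
    (X : R -> T -> R) : Prop := AdaptedIndepIncrements {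
  process_adapted : forall t : R, 0 <= t -> measurable_wrt (F t) (X t) ;
  process_indep : forall s t : R, 0 <= s -> s < t ->
    independent_of P (increment X s t) (F s) }.

(* The second parameter of [normal_prob] is the standard deviation. *)
Record brownian_motion (R : realType) (d : measure_display)
    (T : measurableType d) (P : probability T R) (F : R -> set (set T))
    (W : R -> T -> R) : Prop := BrownianMotion {
  brownian_indep : adapted_indep_increments P F W ;
  brownian_start : {ae P, forall w, W 0 w = 0} ;
  brownian_gauss : forall s t : R, 0 <= s -> s < t ->
    forall B : set R, measurable B ->
    P (increment W s t @^-1` B) = normal_prob 0 (Num.sqrt (t - s)) B ;
  brownian_paths :
    {ae P, forall w, {within `[0, +oo[, continuous (W ^~ w)}} }.

(* [poisson_pmf r] is the Poisson mass function for r > 0 only, whence the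
   strict inequality s < t (and the intensity is meant to be positive). *)
Record poisson_process (R : realType) (d : measure_display)
    (T : measurableType d) (P : probability T R) (F : R -> set (set T))
    (lambda : R) (N : R -> T -> R) : Prop := PoissonProcess {
  poisson_indep : adapted_indep_increments P F N ;
  poisson_start : {ae P, forall w, N 0 w = 0} ;
  poisson_law : forall s t : R, 0 <= s -> s < t -> forall k : nat,
    P (increment N s t @^-1` [set k%:R]) =
      (poisson_pmf (lambda * (t - s)) k)%:E ;
  poisson_paths : {ae P, forall w,
    (forall t : R, 0 <= t -> N s w @[s --> t^'+] --> N t w) /\
    (forall t : R, 0 < t -> cvg (N s w @[s --> t^'-]))} }.

Definition compensated (R : realType) (T : Type) (lambda : R)
    (N : R -> T -> R) : R -> T -> R :=
  fun t w => N t w - lambda * t.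

Fixpoint semi_tamed_euler (R : realType) (T : Type) (u v g h : R -> R)
    (lambda dt : R) (W N : R -> T -> R) (X0 : T -> R) (n : nat) (w : T) : R :=
  if n is m.+1 then
    let Y := semi_tamed_euler u v g h lambda dt W N X0 m w in
    Y + u Y * dt + lambda * h Y * dt + dt * v Y / (1 + dt * `|v Y|)
      + g Y * increment W (m%:R * dt) (m.+1%:R * dt) w
      + h Y * increment (compensated lambda N) (m%:R * dt) (m.+1%:R * dt) w
  else X0 w.

(* The scheme is given as the map sending an initial value to its iterates;
   the constant L does not depend on the initial value. *)
Definition mean_square_stable (R : realType) (d : measure_display)
    (T : measurableType d) (P : probability T R) (F0 : set (set T))
    (scheme : (T -> R) -> nat -> T -> R) : Prop :=
  exists L : R, [/\ 0 < L, L < 1 &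
    forall X0 : T -> R, measurable_wrt F0 X0 ->
      ('E_P[fun w => (`|X0 w| ^+ 2)%R] < +oo)%E ->
      forall n : nat,
        ('E_P[fun w => (`|scheme X0 n.+1 w| ^+ 2)%R] <=
           L%:E * 'E_P[fun w => (`|scheme X0 n w| ^+ 2)%R])%E].

(* Test equation dX = a X dt + b X dW + c X dN, with splitting u(x) = a x and
   v = 0 of the drift. *)
Definition linear_semi_tamed_euler (R : realType) (T : Type) (a b c : R)
    (lambda dt : R) (W N : R -> T -> R) : (T -> R) -> nat -> T -> R :=
  semi_tamed_euler (fun x => a * x) (fun=> 0) (fun x => b * x) (fun x => c * x)
    lambda dt W N.

(* Main.v *)
Require Import Defs.
From HB Require Import structures.
From mathcomp Require Import all_boot all_order all_algebra.
From mathcomp Require Import all_classical all_reals all_analysis.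
From mathcomp Require Import measurable_realfun ring lra.
Set Implicit Arguments.
Unset Strict Implicit.
Unset Printing Implicit Defensive.
Import Order.TTheory GRing.Theory Num.Theory.
Import numFieldNormedType.Exports.
Local Open Scope classical_set_scope.
Local Open Scope ring_scope.

(** Each step multiplies the current value Y by
    1 + a dt + b DW + c DN, where DW and DN are the increments of the two
    driving processes over the step (the compensator of N cancels the extra
    drift lambda c dt). If DW and DN had, given the past, the moments of
    independent Gaussian and Poisson variables, expanding the square would give
    E Y'^2 = rho E Y^2 with
      rho = 1 + dt (l + dt (a + lambda c)^2),
      l = 2 a + b^2 + lambda c (2 + c),
    an equality; hence the scheme is mean-square stable exactly when rho < 1
    (the constant initial value 1 shows necessity), and this is the announced
    bound on dt, because l < 0 forces a + lambda c < 0.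

    The one delicate point is the mixed term E[Z DW DN], Z = Y^2. Each
    process has increments independent of the common past, but this says
    nothing yet about the joint law of DW and DN. The mixed term nevertheless
    vanishes (cross_eq0). It is additive under subdivision of the time interval
    (cross_split), since the products of a past increment of one process with
    a future increment of the other have mean zero (for DN: have mean
    proportional to the mean of Z DW, which is zero). On an interval of length
    h it is o(h): since DN is a natural number,
    |DW| DN <= eps DN^2 + DW^4 / eps^3, whose mean is eps O(h) + O(h^2)/eps^3
    (cross_bound). Repeated halving removes the second part
    (cross_bound_halving), and then eps tends to 0.

    What remains is classical: expectations factor under independence
    (integral_independent, by Fubini), and the first moments of the Gaussian
    and Poisson laws. The Gaussian moments are obtained without integrating by
    parts: the exponential moments E exp(u X) and E exp(- t X^2) are read off
    the normalization of shifted and rescaled densities, and the inequality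
    exp z >= 1 + z, used for parameters of both signs tending to 0, pins down
    E X and E X^2. *)

(** * Real-valued integrals over a probability space *)

Section real_integrals.
Context (R : realType) (d : measure_display) (T : measurableType d).
Variable P : probability T R.
Implicit Types f g : T -> R.

Lemma integrable_dominated f g : measurable_fun setT f ->
    (forall w, `|f w| <= g w) -> P.-integrable setT (EFin \o g) ->
  P.-integrable setT (EFin \o f).
Proof.
move=> mf fg; apply: le_integrable => //; first exact/measurable_EFinP.
by move=> w _; rewrite /= lee_fin (le_trans (fg w))// ler_norm.
Qed.

Lemma integrable_EFinD f g : P.-integrable setT (EFin \o f) ->
  P.-integrable setT (EFin \o g) ->
  P.-integrable setT (EFin \o (fun w => f w + g w)).
Proof. by move=> intf intg; exact: (integrableD measurableT intf intg). Qed.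

Lemma integrable_EFinZ (k : R) f : P.-integrable setT (EFin \o f) ->
  P.-integrable setT (EFin \o (fun w => k * f w)).
Proof. by move=> intf; exact: (integrableZl measurableT k intf). Qed.

Lemma integrable_EFin_norm f : P.-integrable setT (EFin \o f) ->
  P.-integrable setT (EFin \o (fun w => `|f w|)).
Proof. by move=> intf; exact: (integrable_norm intf). Qed.

Lemma integrable_EFin_cst (r : R) :
  P.-integrable setT (EFin \o (cst r : T -> R)).
Proof. exact: finite_measure_integrable_cst. Qed.

Lemma Rintegral_probability_cst (r : R) : \int[P]_w (cst r w) = r.
Proof. by have := expectation_cst P r; rewrite unlock /Rintegral => ->. Qed.

Lemma ge0_integral_EFin f (r : R) : measurable_fun setT f ->
    (forall w, 0 <= f w) -> (\int[P]_w (f w)%:E = r%:E)%E ->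
  P.-integrable setT (EFin \o f) /\ \int[P]_w f w = r.
Proof.
move=> mf f0 fr; split; last by rewrite /Rintegral fr.
apply/integrableP; split; first exact/measurable_EFinP.
under eq_integral => w _ do rewrite /= ger0_norm//.
by rewrite fr ltry.
Qed.

Lemma integrable_sqr f : measurable_fun setT f ->
  P.-integrable setT (EFin \o (fun w => f w ^+ 2)) ->
  P.-integrable setT (EFin \o f).
Proof.
move=> mf if2; apply: (@integrable_dominated _ (fun w => 1 + f w ^+ 2)) => //.
  move=> w; rewrite ler_norml; apply/andP; split; nra.
by apply: integrable_EFinD => //; exact: integrable_EFin_cst.
Qed.

(** An almost-everywhere version of le_Rintegral, since the Poisson increments
    are integers only almost surely. *)
Lemma ae_le_Rintegral f g : P.-integrable setT (EFin \o f) ->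
    P.-integrable setT (EFin \o g) ->
    (forall w, 0 <= f w) -> (forall w, 0 <= g w) ->
    {ae P, forall w, f w <= g w} ->
  \int[P]_w f w <= \int[P]_w g w.
Proof.
move=> intf intg f0 g0 fg; rewrite /Rintegral fine_le ?integrable_fin_num//.
apply: ae_ge0_le_integral => //.
- by move=> w _; rewrite lee_fin.
- exact: measurable_int intf.
- by move=> w _; rewrite lee_fin.
- exact: measurable_int intg.
- by apply: filterS fg => w fgw _; rewrite lee_fin.
Qed.

End real_integrals.

(** * Sub-sigma-algebras and independence *)

Section sub_sigma_algebra.
Context (R : realType) (d : measure_display) (T : measurableType d).
Implicit Types (G : set (set T)) (X Z : T -> R).

(** Transfers to measurable_wrt the closure properties of measurable functions,
    by viewing G as the sigma-algebra of another measurable type. *)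
Lemma measurable_wrtP G X : sigma_algebra setT G ->
  measurable_wrt G X <->
  measurable_fun [set: g_sigma_algebraType G] (X : g_sigma_algebraType G -> R).
Proof.
move=> sG; split=> [mX _ B mB|mX B mB].
  by rewrite setTI; apply: sub_sigma_algebra; exact: mX.
by have := mX measurableT B mB; rewrite setTI /measurable/= sigma_algebra_id.
Qed.

Lemma measurable_wrt_cst G (r : R) : sigma_algebra setT G ->
  measurable_wrt G (cst r : T -> R).
Proof. by move=> sG; apply/measurable_wrtP => //; exact: measurable_cst. Qed.

Lemma measurable_wrt_comp G X (f : R -> R) : measurable_fun setT f ->
  measurable_wrt G X -> measurable_wrt G (f \o X).
Proof.
move=> mf mX B mB; rewrite comp_preimage; apply: mX.
by rewrite -[_ @^-1` _]setTI; exact: mf.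
Qed.

Lemma measurable_wrtD G X Z : sigma_algebra setT G ->
  measurable_wrt G X -> measurable_wrt G Z ->
  measurable_wrt G (fun w => X w + Z w).
Proof.
move=> sG /measurable_wrtP-/(_ sG) mX /measurable_wrtP-/(_ sG) mZ.
by apply/measurable_wrtP => //; exact: measurable_funD.
Qed.

Lemma measurable_wrtB G X Z : sigma_algebra setT G ->
  measurable_wrt G X -> measurable_wrt G Z ->
  measurable_wrt G (fun w => X w - Z w).
Proof.
move=> sG /measurable_wrtP-/(_ sG) mX /measurable_wrtP-/(_ sG) mZ.
by apply/measurable_wrtP => //; exact: measurable_funB.
Qed.

Lemma measurable_wrtM G X Z : sigma_algebra setT G ->
  measurable_wrt G X -> measurable_wrt G Z ->
  measurable_wrt G (fun w => X w * Z w).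
Proof.
move=> sG /measurable_wrtP-/(_ sG) mX /measurable_wrtP-/(_ sG) mZ.
by apply/measurable_wrtP => //; exact: measurable_funM.
Qed.

Lemma measurable_wrtS G G' X : G `<=` G' ->
  measurable_wrt G X -> measurable_wrt G' X.
Proof. by move=> GG' mX B /mX; exact: GG'. Qed.

Lemma measurable_wrt_fun G X : G `<=` measurable ->
  measurable_wrt G X -> measurable_fun setT X.
Proof. by move=> Gm mX _ B mB; rewrite setTI; apply/Gm/mX. Qed.

End sub_sigma_algebra.

Section independence.
Context (R : realType) (d : measure_display) (T : measurableType d).
Variables (P : probability T R) (G : set (set T)).
Hypothesis Gm : G `<=` measurable.
Implicit Types X Z : T -> R.

Lemma independent_of_comp X (f : R -> R) : measurable_fun setT f ->
  independent_of P X G -> independent_of P (f \o X) G.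
Proof.
move=> mf iX B A mB GA; rewrite comp_preimage; apply: iX => //.
by rewrite -[_ @^-1` _]setTI; exact: mf.
Qed.

(** Independence says that the joint law of X and Z is the product of their laws
    on rectangles, hence everywhere; Fubini then factors the integral. *)
Lemma integral_independent X Z : measurable_fun setT X ->
    independent_of P X G -> measurable_wrt G Z ->
    P.-integrable setT (EFin \o X) -> P.-integrable setT (EFin \o Z) ->
  P.-integrable setT (EFin \o (fun w => Z w * X w)) /\
  \int[P]_w (Z w * X w) = \int[P]_w Z w * \int[P]_w X w.
Proof.
move=> mX iX GZ intX intZ.
have mZ := measurable_wrt_fun Gm GZ.
pose X' : {mfun T >-> R} := HB.pack X (isMeasurableFun.Build _ _ _ _ _ mX).
pose Z' : {mfun T >-> R} := HB.pack Z (isMeasurableFun.Build _ _ _ _ _ mZ).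
have mXZ : measurable_fun setT (fun w => (X w, Z w)).
  exact: measurable_fun_pair.
pose XZ : {mfun T >-> (R * R)%type} :=
  HB.pack (fun w => (X w, Z w)) (isMeasurableFun.Build _ _ _ _ _ mXZ).
pose m1 := distribution P X'; pose m2 := distribution P Z'.
have joint A : measurable A -> (m1 \x m2)%E A = distribution P XZ A.
  apply: product_measure_unique => B C mB mC.
  by rewrite -iX//=; exact: GZ.
pose f (z : R * R) : \bar R := (z.2 * z.1)%:E.
have mf : measurable_fun setT f.
  by apply/measurable_EFinP; apply: measurable_funM.
have int1 : m1.-integrable setT EFin by exact: integrable_pushforward.
have int2 : m2.-integrable setT EFin by exact: integrable_pushforward.
have intf : (m1 \x m2)%E.-integrable setT f.
  apply/integrable12ltyP => //.
  have /integrableP[_ i1] := int1; have /integrableP[_ i2] := int2.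
  under eq_integral => x _.
    rewrite (_ : (fun _ => _) = (fun y : R => `|x|%:E * `|y|%:E)%E); last first.
      by apply/funext => y; rewrite /f/= normrM mulrC EFinM.
    rewrite ge0_integralZl//; last first.
      apply/measurable_EFinP; exact: normr_measurable.
    over.
  rewrite ge0_integralZr//.
  - by rewrite lte_mul_pinfty ?integral_ge0// ge0_fin_numE ?integral_ge0//.
  - by apply/measurable_EFinP; exact: normr_measurable.
  - exact: integral_ge0.
have intXZ : P.-integrable setT (f \o XZ).
  apply/integrableP; split.
    exact: measurableT_comp.
  have /integrableP[_] := intf.
  rewrite (eq_measure_integral (distribution P XZ)); last first.
    by move=> A mA _; exact: joint.
  rewrite ge0_integral_distribution//.
  exact: measurableT_comp.
have eqf : (EFin \o (fun w => Z w * X w)) = f \o XZ by [].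
split; first by rewrite eqf.
have eXZ : (\int[P]_w (Z w * X w)%:E = \int[m1 \x m2]_z f z)%E.
  transitivity (\int[distribution P XZ]_z f z)%E.
    by rewrite integral_distribution.
  by apply: eq_measure_integral => A mA _; exact/esym/joint.
have e1 : (\int[m1]_x x%:E = \int[P]_w (X w)%:E)%E by exact: integral_distribution.
have e2 : (\int[m2]_x x%:E = \int[P]_w (Z w)%:E)%E by exact: integral_distribution.
have eF x : fubini_F m2 f x = (x%:E * \int[P]_w (Z w)%:E)%E.
  rewrite -e2 -integralZl//.
  by apply: eq_integral => y _; rewrite /f/= mulrC EFinM.
rewrite /Rintegral eXZ.
transitivity (fine (\int[P]_w (Z w)%:E * \int[m1]_x x%:E)%E); last first.
  by rewrite e1 fineM// integrable_fin_num.
congr fine; rewrite -integral12_prod_meas1//.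
transitivity (\int[m1]_x (x%:E * \int[P]_w (Z w)%:E))%E.
  by apply: eq_integral => x _; exact: eF.
have /fineK <- : (\int[P]_w (Z w)%:E)%E \is a fin_num by exact: integrable_fin_num.
by rewrite integralZr// muleC.
Qed.

End independence.

(** * Gaussian moments *)

Section gaussian_moments.
Context (R : realType) (d : measure_display) (T : measurableType d).
Variables (P : probability T R) (X : T -> R) (sigma : R).
Hypotheses (mX : measurable_fun setT X) (sigma0 : 0 < sigma).
Hypothesis lawX : forall B : set R, measurable B ->
  P (X @^-1` B) = normal_prob 0 sigma B.

Local Notation mu := (@lebesgue_measure R).

(** The normal density is a Radon-Nikodym derivative of the normal law, by
    uniqueness of the latter. *)
Lemma ge0_integral_normal (f : R -> R) :
    measurable_fun setT f -> (forall x, 0 <= f x) ->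
  (\int[P]_w (f (X w))%:E = \int[mu]_x (f x * normal_pdf 0 sigma x)%:E)%E.
Proof.
move=> mf f0.
have mX' : @measurable_fun _ _ T (measurableTypeR R) setT X := mX.
pose X' : {mfun T >-> measurableTypeR R} :=
  HB.pack X (isMeasurableFun.Build _ _ _ _ _ mX').
have mEf : @measurable_fun _ _ (measurableTypeR R) _ setT (EFin \o f).
  by exact/measurable_EFinP.
transitivity (\int[distribution P X']_x (f x)%:E)%E.
  by rewrite ge0_integral_distribution// => x; rewrite lee_fin.
transitivity (\int[normal_prob 0 sigma]_x (f x)%:E)%E.
  by apply: eq_measure_integral => A mA _; exact: lawX.
have dom := normal_prob_dominates 0 sigma.
rewrite -(Radon_Nikodym_SigmaFinite.change_of_variables dom)//.
under [RHS]eq_integral do rewrite EFinM.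
apply: ae_eq_integral => //.
- apply: emeasurable_funM => //.
  exact: measurable_int (Radon_Nikodym_SigmaFinite.f_integrable dom).
- apply: emeasurable_funM => //.
  by apply/measurableT_comp => //; exact: measurable_normal_pdf.
- apply: ae_eqe_mul2l.
  apply: integral_ae_eq => //.
  + exact: (Radon_Nikodym_SigmaFinite.f_integrable dom).
  + by apply/measurableT_comp => //; exact: measurable_normal_pdf.
  + by move=> E _ mE; rewrite -(Radon_Nikodym_SigmaFinite.f_integral dom).
Qed.

(** The exponential factor turns the density of standard deviation sigma into
    s^-1 times the density of standard deviation sigma / s. *)
Lemma integral_normal_expR_sqr (s : R) : 0 < s ->
  (\int[P]_w (expR ((1 - s ^+ 2) * (X w ^+ 2 / (sigma ^+ 2 *+ 2))))%:E =
   (s^-1)%:E)%E.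
Proof.
move=> s0.
have sg0 : sigma != 0 by rewrite gt_eqF.
have sgs0 : sigma / s != 0 by rewrite gt_eqF// divr_gt0.
rewrite (ge0_integral_normal
  (f := fun x => expR ((1 - s ^+ 2) * (x ^+ 2 / (sigma ^+ 2 *+ 2)))))//; last first.
  apply: measurableT_comp => //; apply: measurable_funM => //.
  by apply: measurable_funM => //; apply: measurable_funX.
transitivity (\int[mu]_x ((s^-1)%:E * (normal_pdf 0 (sigma / s) x)%:E))%E.
  apply: eq_integral => x _; rewrite -EFinM; congr EFin.
  rewrite !normal_pdfE// /normal_fun.
  have -> : normal_peak (sigma / s) = s * normal_peak sigma.
    rewrite /normal_peak.
    have -> : (sigma / s) ^+ 2 * pi *+ 2 = s^-1 ^+ 2 * (sigma ^+ 2 * pi *+ 2).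
      by rewrite exprMn exprVn; ring.
    by rewrite sqrtrM ?sqr_ge0// sqrtr_sqr gtr0_norm ?invr_gt0// invfM invrK.
  rewrite mulrCA -expRD [RHS]mulrA mulKf ?gt_eqF//; congr (_ * expR _).
  by field; rewrite sg0 gt_eqF.
rewrite integralZl//; last exact: integrable_normal_pdf.
by rewrite integral_normal_pdf mule1.
Qed.

(** Completing the square: the exponential factor shifts the mean of the density
    to u sigma^2. *)
Lemma integral_normal_expR (u : R) :
  (\int[P]_w (expR (u * X w))%:E = (expR (u ^+ 2 * sigma ^+ 2 / 2))%:E)%E.
Proof.
have sg0 : sigma != 0 by rewrite gt_eqF.
rewrite (ge0_integral_normal (f := fun x => expR (u * x)))//; last first.
  by apply: measurableT_comp => //; apply: measurable_funM.
transitivity (\int[mu]_x ((expR (u ^+ 2 * sigma ^+ 2 / 2))%:E *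
    (normal_pdf (u * sigma ^+ 2) sigma x)%:E))%E.
  apply: eq_integral => x _; rewrite -EFinM; congr EFin.
  rewrite !normal_pdfE// /normal_fun mulrCA -expRD [RHS]mulrCA -expRD.
  congr (_ * expR _).
  by field.
rewrite integralZl//; last exact: integrable_normal_pdf.
by rewrite integral_normal_pdf mule1.
Qed.

Lemma normal_expR_sqr (s : R) : 0 < s ->
  let e := fun w => expR ((1 - s ^+ 2) * (X w ^+ 2 / (sigma ^+ 2 *+ 2))) in
  P.-integrable setT (EFin \o e) /\ \int[P]_w e w = s^-1.
Proof.
move=> s0 e; apply: (@ge0_integral_EFin _ _ _ _ e).
- apply: measurableT_comp => //; apply: measurable_funM => //.
  by apply: measurable_funM => //; exact: measurable_funX.
- by move=> w; exact: expR_ge0.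
- exact: integral_normal_expR_sqr.
Qed.

Lemma normal_expR (u : R) :
  P.-integrable setT (EFin \o (fun w => expR (u * X w))) /\
  \int[P]_w expR (u * X w) = expR (u ^+ 2 * sigma ^+ 2 / 2).
Proof.
apply: (@ge0_integral_EFin _ _ _ _ (fun w => expR (u * X w))).
- by apply: measurableT_comp => //; exact: measurable_funM.
- by move=> w; exact: expR_ge0.
- exact: integral_normal_expR.
Qed.

(** With y = X^2 / (2 sigma^2), y^2 is dominated by exp (3 y / 4), which has
    mean 2. The constant 64 is far from the optimal 3; only the order
    sigma^4 is used. *)
Lemma normal_fourth_moment :
  P.-integrable setT (EFin \o (fun w => X w ^+ 4)) /\
  \int[P]_w (X w ^+ 4) <= 64 * sigma ^+ 4.
Proof.
have sg0 : sigma != 0 by rewrite gt_eqF.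
pose e w := expR ((1 - 2^-1 ^+ 2) * (X w ^+ 2 / (sigma ^+ 2 *+ 2))).
have mX4 : measurable_fun setT (fun w => X w ^+ 4) by exact: measurable_funX.
have [inte Ee] : P.-integrable setT (EFin \o e) /\ \int[P]_w e w = 2^-1^-1.
  by apply: normal_expR_sqr; rewrite invr_gt0.
have X4e w : X w ^+ 4 <= 32 * sigma ^+ 4 * e w.
  pose y := X w ^+ 2 / (sigma ^+ 2 *+ 2).
  have y0 : 0 <= y by rewrite divr_ge0 ?mulrn_wge0 ?sqr_ge0.
  (* (exp (3y/8))^2 >= (1 + 3y/8)^2 >= (9/64) y^2 >= y^2 / 8 *)
  have -> : e w = expR (3 / 8 * y) ^+ 2.
    by rewrite -expRM_natl /e -/y; congr expR; field.
  have -> : X w ^+ 4 = 4 * sigma ^+ 4 * y ^+ 2.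
    by rewrite /y; field.
  have h : 1 + 3 / 8 * y <= expR (3 / 8 * y) by exact: expR_ge1Dx.
  have s4 : 0 <= sigma ^+ 4 by rewrite exprn_ge0// ltW.
  have h2 : y ^+ 2 <= 8 * expR (3 / 8 * y) ^+ 2 by nra.
  have -> : 32 * sigma ^+ 4 * expR (3 / 8 * y) ^+ 2 =
    4 * sigma ^+ 4 * (8 * expR (3 / 8 * y) ^+ 2) by ring.
  by rewrite ler_wpM2l// mulr_ge0.
have intb := integrable_EFinZ (32 * sigma ^+ 4) inte.
have int4 : P.-integrable setT (EFin \o (fun w => X w ^+ 4)).
  apply: integrable_dominated intb => // w.
  by rewrite ger0_norm// exprn_even_ge0.
split=> //; apply: (le_trans (le_Rintegral measurableT int4 intb _)) => //.
by rewrite RintegralZl// Ee invrK; lra.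
Qed.

Lemma integrable_normal_sqr :
  P.-integrable setT (EFin \o (fun w => X w ^+ 2)).
Proof.
apply: integrable_sqr; first exact: measurable_funX.
rewrite (_ : (fun _ => _) = (fun w => X w ^+ 4)); last first.
  by apply/funext => w; rewrite -exprM.
by have [] := normal_fourth_moment.
Qed.

Lemma integrable_normal : P.-integrable setT (EFin \o X).
Proof. by apply: integrable_sqr => //; exact: integrable_normal_sqr. Qed.

(** With m the mean of X^2 / (2 sigma^2), the bound exp z >= 1 + z gives
    1 + (1 - s^2) m <= s^-1 for all s > 0; letting s tend to 1 from either side
    forces m = 1/2. *)
Lemma normal_variance : \int[P]_w (X w ^+ 2) = sigma ^+ 2.
Proof.
have sg0 : sigma != 0 by rewrite gt_eqF.
set V := \int[P]_w _.
pose m := V / (sigma ^+ 2 *+ 2).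
suff m2 : m = 1 / 2.
  have -> : V = m * (sigma ^+ 2 *+ 2) by rewrite /m; field.
  by rewrite m2; field.
have m0 : 0 <= m.
  by rewrite divr_ge0 ?mulrn_wge0 ?sqr_ge0// Rintegral_ge0// => w _; exact: sqr_ge0.
have key s : 0 < s -> 1 + (1 - s ^+ 2) * m <= s^-1.
  move=> s0; have [inte <-] := normal_expR_sqr s0.
  pose c := (1 - s ^+ 2) / (sigma ^+ 2 *+ 2).
  have int1 := integrable_EFin_cst P 1.
  have intc := integrable_EFinZ c integrable_normal_sqr.
  have -> : 1 + (1 - s ^+ 2) * m = \int[P]_w (cst 1 w + c * X w ^+ 2).
    rewrite RintegralD// Rintegral_probability_cst RintegralZl//; last first.
      exact: integrable_normal_sqr.
    by rewrite -/V /m /c; field.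
  apply: le_Rintegral => //; first exact: integrable_EFinD.
  move=> w _; apply: le_trans (expR_ge1Dx _).
  by rewrite lerD2l /c le_eqVlt; apply/orP; left; apply/eqP; field.
(* s = 1 - e refutes m > 1/2, and s = 1 + e refutes m < 1/2. *)
apply: le_anti; apply/andP; split; rewrite leNgt; apply/negP => mlt.
- pose e := (2 * m - 1) / (6 * m).
  have m0' : 0 < m by lra.
  have e6 : e * (6 * m) = 2 * m - 1 by rewrite /e divfK// gt_eqF// mulr_gt0.
  have e0 : 0 < e by rewrite divr_gt0//; lra.
  have e1 : e < 1 by nra.
  have s0 : 0 < 1 - e by lra.
  have := key _ s0; rewrite -(ler_pM2r s0) mulVf ?gt_eqF// => {}key.
  have {key} : e * ((2 - e) * (1 - e) * m) <= e * 1 by lra.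
  rewrite ler_pM2l//; nra.
- pose e := (1 - 2 * m) / 8.
  have e0 : 0 < e by rewrite divr_gt0//; lra.
  have e8 : e * 8 = 1 - 2 * m by rewrite divfK.
  have s0 : 0 < 1 + e by lra.
  have := key _ s0; rewrite -(ler_pM2r s0) mulVf ?gt_eqF// => {}key.
  have {key} : e * 1 <= e * ((2 + e) * (1 + e) * m) by lra.
  rewrite ler_pM2l//; nra.
Qed.

(** The function u -> E exp (u X) = exp (u^2 sigma^2 / 2) lies above the line
    1 + u E X, meets it at u = 0 and has slope 0 there, so E X = 0. *)
Lemma normal_mean : \int[P]_w X w = 0.
Proof.
set m := \int[P]_w _.
pose k := sigma ^+ 2 / 2.
have k0 : 0 <= k by rewrite divr_ge0// sqr_ge0.
have key u : 1 + u * m <= expR (k * u ^+ 2).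
  have -> : k * u ^+ 2 = u ^+ 2 * sigma ^+ 2 / 2 by rewrite /k; field.
  have [inte <-] := normal_expR u.
  have int1 := integrable_EFin_cst P 1.
  have intu := integrable_EFinZ u integrable_normal.
  have -> : 1 + u * m = \int[P]_w (cst 1 w + u * X w).
    rewrite RintegralD// Rintegral_probability_cst RintegralZl//.
    exact: integrable_normal.
  apply: le_Rintegral => //; first exact: integrable_EFinD.
  by move=> w _; exact: expR_ge1Dx.
(* For z < 1, exp z <= 1 / (1 - z) makes the upper bound polynomial in u. *)
have key2 u : 0 < 1 - k * u ^+ 2 -> (1 + u * m) * (1 - k * u ^+ 2) <= 1.
  move=> h.
  have e1 : 1 - k * u ^+ 2 <= expR (- (k * u ^+ 2)) by exact: expR_ge1Dx.
  apply: (@le_trans _ _ (expR (k * u ^+ 2) * expR (- (k * u ^+ 2)))).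
    have := key u; have := expR_gt0 (k * u ^+ 2); nra.
  by rewrite -expRD subrr expR0.
apply/eqP/negPn/negP => mn0.
have m2 : 0 < m ^+ 2 by rewrite exprn_even_gt0.
(* A step u = m dl so small that u m exceeds the quadratic correction. *)
pose dl := (2 * k + m ^+ 2 + 1)^-1.
have dl0 : 0 < dl by rewrite invr_gt0; lra.
have dlE : dl * (2 * k + m ^+ 2 + 1) = 1 by rewrite mulVf// gt_eqF//; lra.
have kd : k * dl < 1 / 2 by nra.
have md : dl * m ^+ 2 < 1 by nra.
have md0 : 0 < dl * m ^+ 2 by nra.
have kd0 : 0 <= k * dl by nra.
have := key2 (m * dl).
have -> : (1 + m * dl * m) * (1 - k * (m * dl) ^+ 2) =
  1 + dl * m ^+ 2 * (1 - k * dl * (1 + dl * m ^+ 2)) by ring.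
have -> : k * (m * dl) ^+ 2 = k * dl * (dl * m ^+ 2) by ring.
have pq : k * dl * (dl * m ^+ 2) < 1 / 2.
  by rewrite (le_lt_trans (ler_piMr kd0 (ltW md))).
have h : 0 < 1 - k * dl * (1 + dl * m ^+ 2) by lra.
have := mulr_gt0 md0 h.
by rewrite subr_gt0 => h' /(_ ltac:(lra)); lra.
Qed.
End gaussian_moments.

(** * Poisson moments *)

Section poisson_moments.
Context (R : realType) (d : measure_display) (T : measurableType d).
Variables (P : probability T R) (X : T -> R) (r : R).
Hypotheses (mX : measurable_fun setT X) (r0 : 0 < r).
Hypothesis lawX : forall k : nat,
  P (X @^-1` [set k%:R]) = (poisson_pmf r k)%:E.

Let F (k : nat) := X @^-1` [set k%:R].

Let mF k : measurable (F k).
Proof. by rewrite -[F k]setTI; exact: mX. Qed.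

Let PF k : P (F k) = (poisson_pmf r k)%:E.
Proof. exact: lawX. Qed.

Let tF : trivIset setT F.
Proof.
apply/trivIsetP => i j _ _ ij; apply/seteqP; split => // w [] Xi Xj.
have : X w = j%:R := Xj; have -> : X w = i%:R := Xi.
by move/eqP; rewrite eqr_nat (negbTE ij).
Qed.

Lemma sum_poisson_pmf : (\sum_(k <oo) (poisson_pmf r k)%:E = 1%E)%E.
Proof.
transitivity (poisson_prob r 0 [set: nat]); last exact: probability_setT.
rewrite /poisson_prob r0 nneseries_esumT// => k.
by rewrite lee_fin poisson_pmf_ge0.
Qed.

Lemma poisson_notnat_null : P (~` \bigcup_k F k) = 0%E.
Proof.
have mU : measurable (\bigcup_k F k) by exact: bigcup_measurable.
have PU : P (\bigcup_k F k) = 1%E.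
  rewrite measure_semi_bigcup// -sum_poisson_pmf.
  by apply: eq_eseriesr => k _; exact: PF.
by rewrite probability_setC// PU subee.
Qed.

(** The law is prescribed on the natural numbers only, but these already carry
    total mass one. *)
Lemma poisson_ae_nat : {ae P, forall w, exists k : nat, X w = k%:R}.
Proof.
exists (~` \bigcup_k F k); split.
- by apply: measurableC; exact: bigcup_measurable.
- exact: poisson_notnat_null.
- by move=> w /= h [k _ Xk]; apply: h; exists k.
Qed.

Lemma ge0_integral_poisson (f : R -> R) :
    measurable_fun setT f -> (forall x, 0 <= f x) ->
  (\int[P]_w (f (X w))%:E = \sum_(k <oo) (f k%:R * poisson_pmf r k)%:E)%E.
Proof.
move=> mf f0.
have mfX : measurable_fun setT (fun w => (f (X w))%:E).
  by apply/measurable_EFinP; exact: measurableT_comp.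
have mU : measurable (\bigcup_k F k) by exact: bigcup_measurable.
rewrite (ge0_negligible_integral (measurableC mU) _ _ _ poisson_notnat_null)//;
  last first.
  by move=> w _; rewrite lee_fin.
rewrite setDE setCK setTI (ge0_integral_bigcup P mF _ _ tF); first last.
- by move=> w _; rewrite lee_fin.
- exact: measurable_funTS.
apply: eq_eseriesr => k _.
rewrite (eq_integral (cst (f k%:R)%:E)); last first.
  by move=> w /set_mem Fw; have {}Fw : X w = k%:R := Fw; rewrite Fw.
by rewrite integral_cst// EFinM; congr (_ * _)%E; exact: PF.
Qed.

Lemma poisson_pmfS k : k.+1%:R * poisson_pmf r k.+1 = r * poisson_pmf r k.
Proof.
rewrite /poisson_pmf r0 exprS factS natrM invfM.
have k0 : k.+1%:R != 0 :> R by rewrite pnatr_eq0.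
have kf : k`!%:R != 0 :> R by rewrite pnatr_eq0 -lt0n fact_gt0.
move: k0 kf; move: (k.+1%:R : R) (k`!%:R : R) => a b a0 b0.
by field; rewrite a0 b0.
Qed.

(** Each Poisson moment reduces to lower ones, because
    k pmf(k) = r pmf(k-1). *)
Lemma sum_poisson_shift (f : nat -> R) : (forall k, 0 <= f k) ->
  (\sum_(k <oo) (k%:R * f k * poisson_pmf r k)%:E =
   r%:E * \sum_(k <oo) (f k.+1 * poisson_pmf r k)%:E)%E.
Proof.
move=> f0; rewrite nneseries_recl//; last first.
  by move=> k _; rewrite lee_fin !mulr_ge0// poisson_pmf_ge0.
rewrite !mul0r add0e -nneseriesZl; last first.
  by move=> k _; rewrite lee_fin mulr_ge0// poisson_pmf_ge0.
rewrite -(nneseries_addn 1); last first.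
  by move=> k; rewrite lee_fin !mulr_ge0// poisson_pmf_ge0.
apply: eq_eseriesr => k _; rewrite addn1 -EFinM; congr EFin.
by rewrite mulrAC poisson_pmfS; ring.
Qed.

Lemma sum_poisson_mean : (\sum_(k <oo) (k%:R * poisson_pmf r k)%:E = r%:E)%E.
Proof.
under eq_eseriesr do rewrite -[X in (X * _)%:E]mulr1.
rewrite (sum_poisson_shift (f := fun=> 1))//.
under eq_eseriesr do rewrite mul1r.
by rewrite sum_poisson_pmf mule1.
Qed.

Lemma poisson_second_moment :
  P.-integrable setT (EFin \o (fun w => X w ^+ 2)) /\
  \int[P]_w (X w ^+ 2) = r ^+ 2 + r.
Proof.
apply: (@ge0_integral_EFin _ _ _ _ (fun w => X w ^+ 2)).
- exact: measurable_funX.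
- by move=> w; exact: sqr_ge0.
have msq : measurable_fun setT (fun x : R => x ^+ 2) by exact: measurable_funX.
rewrite (ge0_integral_poisson msq (@sqr_ge0 R)).
under eq_eseriesr do rewrite expr2.
rewrite (sum_poisson_shift (f := fun k => k%:R))//.
under eq_eseriesr do rewrite -natr1 mulrDl mul1r EFinD.
rewrite nneseriesD; last 2 first.
- by move=> k _ _; rewrite lee_fin mulr_ge0// poisson_pmf_ge0.
- by move=> k _ _; rewrite lee_fin poisson_pmf_ge0.
rewrite sum_poisson_mean sum_poisson_pmf -EFinD -EFinM; congr EFin; ring.
Qed.

Lemma integrable_poisson : P.-integrable setT (EFin \o X).
Proof. by apply: integrable_sqr => //; have [] := poisson_second_moment. Qed.

Lemma poisson_mean : \int[P]_w X w = r.
Proof.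
rewrite /Rintegral (ae_eq_integral (fun w => `|X w|%:E))//; first last.
- apply: filterS poisson_ae_nat => w [k Xk] _ /=.
  by rewrite Xk normr_nat.
- by apply/measurable_EFinP; exact: measurableT_comp.
- exact/measurable_EFinP.
rewrite (ge0_integral_poisson (@normr_measurable R setT) (@normr_ge0 R R)).
by under eq_eseriesr do rewrite normr_nat; rewrite sum_poisson_mean.
Qed.

End poisson_moments.

(** * Increments of the driving processes *)

Section increments.
Context (R : realType) (d : measure_display) (T : measurableType d).
Variables (P : probability T R) (F : R -> set (set T)).
Hypothesis hF : is_filtration F.

Section process.
Variable X : R -> T -> R.
Hypothesis hX : adapted_indep_increments P F X.

Lemma measurable_wrt_increment (s t : R) : 0 <= s -> s <= t ->
  measurable_wrt (F t) (increment X s t).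
Proof.
move=> s0 st; have t0 := le_trans s0 st.
apply: measurable_wrtB; first exact: filtration_sigma hF _ t0.
  exact: process_adapted hX _ t0.
exact: measurable_wrtS (filtration_mono hF s0 st) (process_adapted hX s0).
Qed.

Lemma measurable_increment (s t : R) : 0 <= s -> s <= t ->
  measurable_fun setT (increment X s t).
Proof.
move=> s0 st; have t0 := le_trans s0 st.
by apply: measurable_wrt_fun (filtration_sub hF t0) _; exact: measurable_wrt_increment.
Qed.

(** Conditioning on the past at time s, in integrated form: functions of the
    increment after s can be averaged separately. *)
Lemma integral_past_increment (s t : R) (f : R -> R) (Z : T -> R) :
    0 <= s -> s < t -> measurable_fun setT f ->
    P.-integrable setT (EFin \o (fun w => f (increment X s t w))) ->
    measurable_wrt (F s) Z -> P.-integrable setT (EFin \o Z) ->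
  P.-integrable setT (EFin \o (fun w => Z w * f (increment X s t w))) /\
  \int[P]_w (Z w * f (increment X s t w)) =
    \int[P]_w Z w * \int[P]_w f (increment X s t w).
Proof.
move=> s0 st mf intf FZ intZ.
apply: (integral_independent (filtration_sub hF s0)
  (X := f \o increment X s t)) => //.
- by apply: measurableT_comp => //; apply: measurable_increment => //; exact: ltW.
- by apply: independent_of_comp => //; exact: process_indep hX _ _ s0 st.
Qed.

End process.

Variables (W N : R -> T -> R) (lambda : R).
Hypotheses (hlambda : 0 < lambda) (hW : brownian_motion P F W)
  (hN : poisson_process P F lambda N).

Let iW := brownian_indep hW.
Let iN := poisson_indep hN.

Section one_step.
Variables (s t : R) (Z : T -> R).
Hypotheses (s0 : 0 <= s) (st : s < t).
Hypotheses (FZ : measurable_wrt (F s) Z)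
  (intZ : P.-integrable setT (EFin \o Z)).

Let dW := increment W s t.
Let dN := increment N s t.
Let st0 : 0 < t - s. Proof. by rewrite subr_gt0. Qed.
Let mdW : measurable_fun setT dW.
Proof. by apply: (measurable_increment iW) => //; exact: ltW. Qed.
Let mdN : measurable_fun setT dN.
Proof. by apply: (measurable_increment iN) => //; exact: ltW. Qed.
Let sig0 : 0 < Num.sqrt (t - s). Proof. by rewrite sqrtr_gt0. Qed.
Let lawW := brownian_gauss hW s0 st.
Let rate0 : 0 < lambda * (t - s). Proof. exact: mulr_gt0. Qed.
Let lawN := poisson_law hN s0 st.
Let mZ : measurable_fun setT Z.
Proof. exact: measurable_wrt_fun (filtration_sub hF s0) FZ. Qed.

Lemma brownian_past_mean : P.-integrable setT (EFin \o (fun w => Z w * dW w)) /\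
  \int[P]_w (Z w * dW w) = 0.
Proof.
have intW := integrable_normal mdW sig0 lawW.
have [? ->] := integral_past_increment iW s0 st
  (@measurable_id _ _ setT) intW FZ intZ.
by split => //; rewrite (normal_mean mdW sig0 lawW) mulr0.
Qed.

Lemma brownian_past_sqr :
  P.-integrable setT (EFin \o (fun w => Z w * dW w ^+ 2)) /\
  \int[P]_w (Z w * dW w ^+ 2) = \int[P]_w Z w * (t - s).
Proof.
have intW := integrable_normal_sqr mdW sig0 lawW.
have msq : measurable_fun setT (fun x : R => x ^+ 2) by exact: measurable_funX.
have [? ->] := integral_past_increment iW s0 st msq intW FZ intZ.
by split => //; rewrite (normal_variance mdW sig0 lawW) sqr_sqrtr// ltW.
Qed.

Lemma brownian_past_pow4 :
  P.-integrable setT (EFin \o (fun w => Z w * dW w ^+ 4)) /\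
  ((forall w, 0 <= Z w) ->
   \int[P]_w (Z w * dW w ^+ 4) <= \int[P]_w Z w * (64 * (t - s) ^+ 2)).
Proof.
have [intW W4] := normal_fourth_moment mdW sig0 lawW.
have m4 : measurable_fun setT (fun x : R => x ^+ 4) by exact: measurable_funX.
have [? ->] := integral_past_increment iW s0 st m4 intW FZ intZ.
split => // Z0; rewrite ler_wpM2l ?Rintegral_ge0//.
apply: le_trans W4 _.
by rewrite (_ : 4 = 2 * 2)%N// exprM sqr_sqrtr// ltW.
Qed.

Lemma poisson_past_mean : P.-integrable setT (EFin \o (fun w => Z w * dN w)) /\
  \int[P]_w (Z w * dN w) = \int[P]_w Z w * (lambda * (t - s)).
Proof.
have intN := integrable_poisson mdN rate0 lawN.
have [? ->] := integral_past_increment iN s0 st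
  (@measurable_id _ _ setT) intN FZ intZ.
by split => //; rewrite (poisson_mean mdN rate0 lawN).
Qed.

Lemma poisson_past_sqr :
  P.-integrable setT (EFin \o (fun w => Z w * dN w ^+ 2)) /\
  \int[P]_w (Z w * dN w ^+ 2) =
    \int[P]_w Z w * ((lambda * (t - s)) ^+ 2 + lambda * (t - s)).
Proof.
have [intN EN] := poisson_second_moment mdN rate0 lawN.
have msq : measurable_fun setT (fun x : R => x ^+ 2) by exact: measurable_funX.
have [? ->] := integral_past_increment iN s0 st msq intN FZ intZ.
by split => //; rewrite EN.
Qed.

Lemma integrable_cross :
  P.-integrable setT (EFin \o (fun w => Z w * dW w * dN w)).
Proof.
have [intW _] := brownian_past_sqr; have [intN _] := poisson_past_sqr.
have intb := integrable_EFinD (integrable_EFin_norm intW)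
  (integrable_EFin_norm intN).
apply: integrable_dominated intb.
  by apply: measurable_funM => //; exact: measurable_funM.
move=> w; rewrite -mulrA !(normrM (Z w)) -mulrDr ler_wpM2l// normrM !normrX.
have := sqr_ge0 (`|dW w| - `|dN w|); have := normr_ge0 (dW w).
have := normr_ge0 (dN w); nra.
Qed.

End one_step.

(** Where |x| <= eps, use k <= k^2; elsewhere |x| k <= eps k^2 + x^2 / eps and
    x^2 <= x^4 / eps^2. The first case fails for fractional k, so that
    the bound reflects the jumps of N being integers. *)
Lemma norm_mul_nat_le (eps x : R) (k : nat) : 0 < eps ->
  `|x| * k%:R <= eps * k%:R ^+ 2 + (eps ^+ 3)^-1 * x ^+ 4.
Proof.
move=> eps0; case: k => [|k].
  rewrite mulr0 expr0n mulr0 add0r mulr_ge0 ?exprn_even_ge0//.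
  by rewrite invr_ge0 exprn_ge0// ltW.
have k1 : 1 <= k.+1%:R :> R by rewrite ler1n.
move: (k.+1%:R) k1 => n n1.
have -> : x ^+ 4 = `|x| ^+ 4.
  by rewrite (_ : 4 = 2 * 2)%N// !exprM real_normK// num_real.
move: (normr_ge0 x); move: `|x| => y y0.
have i0 : 0 <= (eps ^+ 3)^-1 * y ^+ 4.
  by rewrite mulr_ge0 ?invr_ge0 ?exprn_ge0 ?(ltW eps0).
have [yeps|epsy] := leP y eps.
  apply: (@le_trans _ _ (eps * n ^+ 2)); last by rewrite lerDl.
  apply: ler_pM => //; first by rewrite (le_trans _ n1).
  by rewrite ler_eXnr.
pose z := y / eps.
have -> : y = eps * z by rewrite /z; field; rewrite gt_eqF.
have z1 : 1 <= z by rewrite ler_pdivlMr// mul1r ltW.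
have -> : (eps ^+ 3)^-1 * (eps * z) ^+ 4 = eps * z ^+ 4.
  by field; rewrite gt_eqF.
rewrite -mulrA -mulrDr ler_wpM2l ?ltW//.
have z2 : 1 <= z ^+ 2 by nra.
have z24 : z ^+ 2 <= z ^+ 4 by apply: ler_weXn2l.
have := sqr_ge0 (z - n); have := sqr_ge0 n; have := sqr_ge0 z.
rewrite sqrrB; lra.
Qed.

Let cross (Z : T -> R) s t :=
  \int[P]_w (Z w * increment W s t w * increment N s t w).

(** Only the separate laws of the two increments enter: on an interval of
    length h, their mixed moment is eps O(h) + O(h^2) / eps^3. *)
Lemma cross_bound (eps s t : R) (Z : T -> R) : 0 < eps -> 0 <= s -> s < t ->
    measurable_wrt (F s) Z -> P.-integrable setT (EFin \o Z) ->
  `|cross Z s t| <= (eps * ((lambda * (t - s)) ^+ 2 + lambda * (t - s)) +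
     (eps ^+ 3)^-1 * (64 * (t - s) ^+ 2)) * \int[P]_w `|Z w|.
Proof.
move=> eps0 s0 st FZ intZ.
have FZ' : measurable_wrt (F s) (fun w => `|Z w|).
  by apply: (measurable_wrt_comp (f := Num.norm)) => //; exact: normr_measurable.
have intZ' := integrable_EFin_norm intZ.
have intC := integrable_cross s0 st FZ intZ.
have [intW leW] := brownian_past_pow4 s0 st FZ' intZ'.
have [intN eqN] := poisson_past_sqr s0 st FZ' intZ'.
have {}leW := leW (fun w => normr_ge0 (Z w)).
have intb1 := integrable_EFinZ eps intN.
have intb2 := integrable_EFinZ (eps ^+ 3)^-1 intW.
apply: le_trans (le_normr_Rintegral measurableT intC) _.
apply: (@le_trans _ _ (\int[P]_w (eps * (`|Z w| * increment N s t w ^+ 2) +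
    (eps ^+ 3)^-1 * (`|Z w| * increment W s t w ^+ 4)))).
  apply: ae_le_Rintegral.
  - exact: integrable_EFin_norm.
  - exact: integrable_EFinD.
  - by [].
  - move=> w; apply: addr_ge0; apply: mulr_ge0.
    + exact: ltW.
    + by rewrite mulr_ge0// sqr_ge0.
    + by rewrite invr_ge0 exprn_ge0// ltW.
    + by rewrite mulr_ge0// exprn_even_ge0.
  have mN : measurable_fun setT (increment N s t).
    by apply: (measurable_increment iN) => //; exact: ltW.
  have rate0 : 0 < lambda * (t - s) by rewrite mulr_gt0// subr_gt0.
  apply: filterS (poisson_ae_nat mN rate0 (poisson_law hN s0 st)) => w [k ->].
  rewrite !normrM normr_nat -mulrA.
  rewrite [eps * _]mulrCA [_^-1 * _]mulrCA -mulrDr ler_wpM2l//.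
  exact: norm_mul_nat_le.
rewrite RintegralD// !RintegralZl// eqN mulrDl lerD//.
  by rewrite -mulrA [X in eps * X]mulrC.
by rewrite -mulrA ler_wpM2l ?invr_ge0 ?exprn_ge0 ?(ltW eps0)// mulrC.
Qed.

(** The off-diagonal products vanish: over [u, t] each process is independent of
    the past at u, the increment of W being centred, and that of N
    contributing its mean times the vanishing integral of Z against the
    increment of W over [s, u]. *)
Lemma cross_split (s u t : R) (Z : T -> R) : 0 <= s -> s < u -> u < t ->
    measurable_wrt (F s) Z -> P.-integrable setT (EFin \o Z) ->
  cross Z s t = cross Z s u + cross Z u t.
Proof.
move=> s0 su ut FZ intZ; have u0 : 0 <= u by rewrite (le_trans s0)// ltW.
have FuZ : measurable_wrt (F u) Z.
  exact: measurable_wrtS (filtration_mono hF s0 (ltW su)) FZ.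
have sF := filtration_sigma hF u0.
have [intW1 EW1] := brownian_past_mean s0 su FZ intZ.
have [intN1 _] := poisson_past_mean s0 su FZ intZ.
have FW : measurable_wrt (F u) (fun w => Z w * increment W s u w).
  by apply: measurable_wrtM => //;
    apply: (measurable_wrt_increment iW) => //; exact: ltW.
have FN : measurable_wrt (F u) (fun w => Z w * increment N s u w).
  by apply: measurable_wrtM => //;
    apply: (measurable_wrt_increment iN) => //; exact: ltW.
have [intWN EWN] := poisson_past_mean u0 ut FW intW1.
have [intNW ENW] := brownian_past_mean u0 ut FN intN1.
have int1 := integrable_cross s0 su FZ intZ.
have int2 := integrable_cross u0 ut FuZ intZ.
transitivity (\int[P]_w
   ((Z w * increment W s u w * increment N s u w +
     Z w * increment W u t w * increment N u t w) +
    (Z w * increment W s u w * increment N u t w +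
     Z w * increment N s u w * increment W u t w))).
  by apply: eq_Rintegral => w _; rewrite /increment; ring.
rewrite RintegralD//; last 2 first.
- exact: (integrable_EFinD int1 int2).
- exact: (integrable_EFinD intWN intNW).
by rewrite !RintegralD// EWN ENW EW1 mul0r !addr0.
Qed.

(** Two halves of the interval: the term in h^2 is divided by 2 at each
    subdivision while the term in h is preserved. *)
Lemma cross_bound_halving (eps : R) (k : nat) : 0 < eps ->
  forall (s t : R) (Z : T -> R), 0 <= s -> s < t ->
    measurable_wrt (F s) Z -> P.-integrable setT (EFin \o Z) ->
  `|cross Z s t| <= (eps * ((lambda * (t - s)) ^+ 2 + lambda * (t - s)) +
     (eps ^+ 3)^-1 * (64 * (t - s) ^+ 2) / 2 ^+ k) * \int[P]_w `|Z w|.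
Proof.
move=> eps0; elim: k => [|k IH] s t Z s0 st FZ intZ.
  by rewrite expr0 divr1; exact: cross_bound.
pose u := (s + t) / 2.
have su : s < u by rewrite /u; lra.
have ut : u < t by rewrite /u; lra.
have u0 : 0 <= u by rewrite (le_trans s0)// ltW.
have FuZ : measurable_wrt (F u) Z.
  exact: measurable_wrtS (filtration_mono hF s0 (ltW su)) FZ.
rewrite (cross_split s0 su ut FZ intZ) (le_trans (ler_normD _ _))//.
have := lerD (IH _ _ _ s0 su FZ intZ) (IH _ _ _ u0 ut FuZ intZ).
move=> /le_trans; apply; rewrite -mulrDl ler_wpM2r ?Rintegral_ge0//.
have -> : u - s = (t - s) / 2 by rewrite /u; field.
have -> : t - u = (t - s) / 2 by rewrite /u; field.
rewrite [2 ^+ k.+1]exprS (invfM 2); set h := t - s.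
set i := (2 ^+ k)^-1; set j := (eps ^+ 3)^-1.
have : 0 <= eps * (lambda * h) ^+ 2 by rewrite mulr_ge0 ?sqr_ge0// ltW.
lra.
Qed.

(** A Brownian motion and a Poisson process for the same filtration are
    conditionally uncorrelated: by subdivision, the mixed moment is at most
    eps O(h) for every eps. *)
Lemma cross_eq0 (s t : R) (Z : T -> R) : 0 <= s -> s < t ->
    measurable_wrt (F s) Z -> P.-integrable setT (EFin \o Z) ->
  \int[P]_w (Z w * increment W s t w * increment N s t w) = 0.
Proof.
move=> s0 st FZ intZ; rewrite -/(cross Z s t).
set h := t - s; set A := \int[P]_w `|Z w|.
have h0 : 0 < h by rewrite subr_gt0.
have A0 : 0 <= A by rewrite Rintegral_ge0.
pose K := ((lambda * h) ^+ 2 + lambda * h + 1) * A.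
have K0 : 0 <= K.
  by rewrite mulr_ge0// addr_ge0// addr_ge0 ?sqr_ge0// mulr_ge0 ?ltW.
have small eps : 0 < eps -> `|cross Z s t| <= eps * K.
  move=> eps0.
  pose B := (eps ^+ 3)^-1 * (64 * h ^+ 2).
  (* 2^k >= k >= B / eps *)
  pose k := Num.bound (B / eps).
  have B0 : 0 <= B by rewrite mulr_ge0 ?invr_ge0 ?exprn_ge0 ?mulr_ge0 ?ltW.
  have Bk : B / 2 ^+ k <= eps.
    rewrite ler_pdivrMr ?exprn_gt0// -ler_pdivrMl// mulrC.
    have := archi_boundP (divr_ge0 B0 (ltW eps0)); rewrite -/k.
    move=> /ltW/le_trans; apply.
    by rewrite -natrX ler_nat ltnW// ltn_expl.
  apply: le_trans (cross_bound_halving k eps0 s0 st FZ intZ) _.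
  by rewrite -/h -/A /K [leRHS]mulrA ler_wpM2r// [leRHS]mulrDr mulr1 lerD2l.
have [//|C0] := eqVneq (cross Z s t) 0.
have Cgt : 0 < `|cross Z s t| by rewrite normr_gt0.
have K1 : 0 < K + 1 by lra.
have := small (`|cross Z s t| / (2 * (K + 1)))
  (divr_gt0 Cgt (mulr_gt0 (ltr0Sn _ 1) K1)).
rewrite -mulrA ler_pMr// => {}small.
have : (2 * (K + 1))^-1 * K < 1.
  by rewrite mulrC ltr_pdivrMr ?mulr_gt0//; lra.
by rewrite ltNge small.
Qed.

(** Expanding the square leaves six conditional moments; the mean of the Brownian
    increment and the mixed moment vanish. *)
Lemma mean_square_step (s h b c al : R) (Y : T -> R) : 0 <= s -> 0 < h ->
    measurable_wrt (F s) Y ->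
    P.-integrable setT (EFin \o (fun w => Y w ^+ 2)) ->
  let Y' w := Y w * (al + b * increment W s (s + h) w
                        + c * increment N s (s + h) w) in
  [/\ measurable_wrt (F (s + h)) Y',
      P.-integrable setT (EFin \o (fun w => Y' w ^+ 2)) &
      \int[P]_w (Y' w ^+ 2) =
        (al ^+ 2 + b ^+ 2 * h + c ^+ 2 * ((lambda * h) ^+ 2 + lambda * h)
         + 2 * al * c * (lambda * h)) * \int[P]_w (Y w ^+ 2)].
Proof.
move=> s0 h0 FY intZ Y'.
have st : s < s + h by rewrite ltrDl.
have t0 : 0 <= s + h by rewrite addr_ge0// ltW.
have sF := filtration_sigma hF t0.
have eh : s + h - s = h by rewrite addrC addKr.
pose Z w := Y w ^+ 2.
have FZ : measurable_wrt (F s) Z.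
  by apply: (measurable_wrt_comp (f := fun x => x ^+ 2)) => //; exact: measurable_funX.
have FW := measurable_wrt_increment iW s0 (ltW st).
have FN := measurable_wrt_increment iN s0 (ltW st).
have FtY : measurable_wrt (F (s + h)) Y.
  exact: measurable_wrtS (filtration_mono hF s0 (ltW st)) FY.
have [iW1 EW1] := brownian_past_mean s0 st FZ intZ.
have [iW2 EW2] := brownian_past_sqr s0 st FZ intZ.
have [iN1 EN1] := poisson_past_mean s0 st FZ intZ.
have [iN2 EN2] := poisson_past_sqr s0 st FZ intZ.
have iC := integrable_cross s0 st FZ intZ.
have EC := cross_eq0 s0 st FZ intZ.
have j0 := integrable_EFinZ (al ^+ 2) intZ.
have j1 := integrable_EFinZ (b ^+ 2) iW2.
have j2 := integrable_EFinZ (c ^+ 2) iN2.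
have j3 := integrable_EFinZ (2 * al * b) iW1.
have j4 := integrable_EFinZ (2 * al * c) iN1.
have j5 := integrable_EFinZ (2 * b * c) iC.
have j01 := integrable_EFinD j0 j1.
have j02 := integrable_EFinD j01 j2.
have j03 := integrable_EFinD j02 j3.
have j04 := integrable_EFinD j03 j4.
have j05 := integrable_EFinD j04 j5.
have eqY w : Y' w ^+ 2 = al ^+ 2 * Z w
  + b ^+ 2 * (Z w * increment W s (s + h) w ^+ 2)
  + c ^+ 2 * (Z w * increment N s (s + h) w ^+ 2)
  + 2 * al * b * (Z w * increment W s (s + h) w)
  + 2 * al * c * (Z w * increment N s (s + h) w)
  + 2 * b * c * (Z w * increment W s (s + h) w * increment N s (s + h) w).
  by rewrite /Y' /Z; ring.
split.
- apply: measurable_wrtM => //; apply: measurable_wrtD => //.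
    apply: measurable_wrtD => //; first exact: measurable_wrt_cst.
    by apply: measurable_wrtM => //; exact: measurable_wrt_cst.
  by apply: measurable_wrtM => //; exact: measurable_wrt_cst.
- by apply: eq_integrable j05 => // w _; rewrite /= eqY.
- under eq_Rintegral do rewrite eqY.
  rewrite RintegralD// RintegralD// RintegralD// RintegralD// RintegralD//.
  rewrite !RintegralZl// EW1 EW2 EN1 EN2 EC eh -/(Z _).
  rewrite -[\int[P]_w (Y w ^+ 2)]/(\int[P]_w Z w); ring.
Qed.

End increments.

(** * The linear scheme *)

Section linear_scheme.
Context (R : realType) (d : measure_display) (T : measurableType d).
Variables (P : probability T R) (F : R -> set (set T)).
Variables (W N : R -> T -> R) (a b c lambda dt : R).
Hypotheses (hF : is_filtration F) (hlambda : 0 < lambda) (hdt : 0 < dt).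
Hypotheses (hW : brownian_motion P F W) (hN : poisson_process P F lambda N).

Local Notation Y := (linear_semi_tamed_euler a b c lambda dt W N).

(** The ratio of consecutive second moments of the scheme. *)
Definition growth_factor : R :=
  1 + dt * (2 * a + b ^+ 2 + lambda * c * (2 + c) + dt * (a + lambda * c) ^+ 2).

Lemma linear_semi_tamed_eulerS (X0 : T -> R) (n : nat) (w : T) :
  Y X0 n.+1 w = Y X0 n w * (1 + a * dt
    + b * increment W (n%:R * dt) (n%:R * dt + dt) w
    + c * increment N (n%:R * dt) (n%:R * dt + dt) w).
Proof.
have -> : n%:R * dt + dt = n.+1%:R * dt by rewrite -natr1 mulrDl mul1r.
rewrite /linear_semi_tamed_euler /=.
set y := semi_tamed_euler _ _ _ _ _ _ _ _ _ _ _.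
rewrite mulr0 mul0r /increment /compensated -[n.+1%:R]natr1; ring.
Qed.

Lemma mean_square_growth (X0 : T -> R) :
    measurable_wrt (F 0) X0 ->
    P.-integrable setT (EFin \o (fun w => X0 w ^+ 2)) ->
  forall n, [/\ measurable_wrt (F (n%:R * dt)) (Y X0 n),
    P.-integrable setT (EFin \o (fun w => Y X0 n w ^+ 2)) &
    \int[P]_w (Y X0 n.+1 w ^+ 2) =
      growth_factor * \int[P]_w (Y X0 n w ^+ 2)].
Proof.
move=> FX intX.
have step n : measurable_wrt (F (n%:R * dt)) (Y X0 n) ->
    P.-integrable setT (EFin \o (fun w => Y X0 n w ^+ 2)) ->
  [/\ measurable_wrt (F (n.+1%:R * dt)) (Y X0 n.+1),
    P.-integrable setT (EFin \o (fun w => Y X0 n.+1 w ^+ 2)) &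
    \int[P]_w (Y X0 n.+1 w ^+ 2) =
      growth_factor * \int[P]_w (Y X0 n w ^+ 2)].
  move=> FY intY.
  have s0 : 0 <= n%:R * dt by rewrite mulr_ge0// ltW.
  have [FY' intY' EY'] :=
    mean_square_step hF hlambda hW hN b c (1 + a * dt) s0 hdt FY intY.
  have YE : Y X0 n.+1 = (fun w => Y X0 n w * (1 + a * dt
    + b * increment W (n%:R * dt) (n%:R * dt + dt) w
    + c * increment N (n%:R * dt) (n%:R * dt + dt) w)).
    by apply/funext => w; exact: linear_semi_tamed_eulerS.
  rewrite -[n.+1%:R]natr1 mulrDl mul1r YE; split => //.
  by rewrite EY' /growth_factor; congr (_ * _); ring.
suff mi n : measurable_wrt (F (n%:R * dt)) (Y X0 n) /\
    P.-integrable setT (EFin \o (fun w => Y X0 n w ^+ 2)).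
  by move=> n; have [FY intY] := mi n; have [_ _ ?] := step n FY intY.
elim: n => [|n [FY intY]]; first by rewrite mul0r.
by have [] := step n FY intY.
Qed.

Lemma expectation_sqr (X : T -> R) :
  P.-integrable setT (EFin \o (fun w => X w ^+ 2)) ->
  ('E_P[fun w => (`|X w| ^+ 2)%R] = (\int[P]_w (X w ^+ 2))%R%:E)%E.
Proof.
move=> intX; rewrite unlock /Rintegral fineK; last exact: integrable_fin_num.
by apply: eq_integral => w _; rewrite real_normK// num_real.
Qed.

Lemma integrable_sqr_expectation (X : T -> R) : measurable_fun setT X ->
  ('E_P[fun w => (`|X w| ^+ 2)%R] < +oo)%E ->
  P.-integrable setT (EFin \o (fun w => X w ^+ 2)).
Proof.
move=> mX; rewrite unlock => EX; apply/integrableP; split.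
  by apply/measurable_EFinP; exact: measurable_funX.
by under eq_integral do rewrite /= normrX.
Qed.

(** The second moment is multiplied by exactly growth_factor at each step; the
    initial value 1 makes it nonzero, so that a ratio L < 1 is only possible
    when growth_factor < 1. *)
Lemma mean_square_stableP :
  mean_square_stable P (F 0) Y <-> growth_factor < 1.
Proof.
split=> [[L [_ L1 HL]]|rho1].
  have sF0 := filtration_sigma hF (lexx 0).
  have F1 : measurable_wrt (F 0) (cst 1 : T -> R) by exact: measurable_wrt_cst.
  have int1 : P.-integrable setT (EFin \o (fun w => (cst 1 : T -> R) w ^+ 2)).
    by rewrite (_ : (fun _ => _) = cst (1 ^+ 2))//; exact: integrable_EFin_cst.
  have E1 : ('E_P[fun w => (`|(cst 1 : T -> R) w| ^+ 2)%R] < +oo)%E.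
    by rewrite expectation_sqr// ltry.
  have growth := mean_square_growth F1 int1.
  have [_ _ E10] := growth 0%N; have [_ int11 _] := growth 1%N.
  have := HL (cst 1) F1 E1 0%N; rewrite !expectation_sqr// E10 -EFinM lee_fin.
  have -> : \int[P]_w (Y (cst 1) 0 w ^+ 2) = 1.
    under eq_Rintegral do rewrite /= expr1n.
    exact: Rintegral_probability_cst.
  by rewrite !mulr1 => /le_lt_trans; apply.
(* The maximum with 1/2 keeps L positive should growth_factor vanish. *)
exists (Num.max growth_factor (1 / 2)); split.
- by rewrite lt_max divr_gt0 ?orbT.
- by rewrite gt_max rho1/=; lra.
move=> X0 FX EX n.
have mX := measurable_wrt_fun (filtration_sub hF (lexx 0)) FX.
have growth := mean_square_growth FX (integrable_sqr_expectation mX EX).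
have [_ intn En] := growth n; have [_ intn1 _] := growth n.+1.
rewrite !expectation_sqr// En -EFinM lee_fin ler_wpM2r ?le_max ?lexx//.
by apply: Rintegral_ge0 => w _; exact: sqr_ge0.
Qed.

End linear_scheme.

Theorem theorem5p5p2 (R : realType) (d : measure_display)
    (T : measurableType d) (P : probability T R) (F : R -> set (set T))
    (W N : R -> T -> R) (a b c lambda : R)
    (hF : is_filtration F)
    (hlambda : 0 < lambda)
    (hW : brownian_motion P F W)
    (hN : poisson_process P F lambda N)
    (hl : 2 * a + b ^+ 2 + lambda * c * (2 + c) < 0)
    (dt : R) (hdt : 0 < dt) :
  mean_square_stable P (F 0) (linear_semi_tamed_euler a b c lambda dt W N)
  <->
  dt < - (2 * a + b ^+ 2 + lambda * c * (2 + c)) / (a + lambda * c) ^+ 2.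
Proof.
(* l = 2 (a + lambda c) + b^2 + lambda c^2, so the denominator is nonzero. *)
have al0 : a + lambda * c < 0.
  have := sqr_ge0 b; have : 0 <= lambda * c ^+ 2.
    by rewrite mulr_ge0 ?sqr_ge0 ?ltW.
  lra.
have al2 : 0 < (a + lambda * c) ^+ 2 by rewrite exprn_even_gt0//= lt_eqF.
apply: iff_trans (mean_square_stableP a b c hF hlambda hdt hW hN) _.
by rewrite /growth_factor ltr_pdivlMr// gtrDl pmulr_rlt0// addrC -ltrBrDr sub0r.
Qed.
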